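(* All the irreducible $gl_d\times gl_{m+p|n+q}$-submodules of $\mathbb{C}[\mathbf{x},\mathbf{y},\boldsymbol\eta,\boldsymbol\zeta]$ are of highest weight type with respect to the Borel subalgebra $\mathfrak{b}_d\times B$.
   Context: Ground field $\mathbb{C}$; $d\ge 1$, $m,n,p,q\ge 0$ integers. ''Of highest weight type'' means generated by a highest weight vector with respect to the given Borel subalgebra. **Algebras.** $gl_d$ has elementary matrices $e_{ij}$, and $\mathfrak{b}_d=\sum_{i\le j}\mathbb{C}e_{ij}$. $gl_{m+p|n+q}$ is the Lie superalgebra of endomorphisms of the superspace with basis $v_A$, $A\in\{1,\dots,m+n+p+q\}$, where $v_A$ is even for $1\le A\le p$ and for $p+q+1\le A\le p+q+m$, and odd otherwise; $E^A_Cv_D=\delta_{CD}v_A$. $B=\sum_{A\le C}\mathbb{C}E^A_C$ is a (non-standard) Borel subalgebra with Cartan subalgebra $\sum_A\mathbb{C}E^A_A$. **Action.** $\mathbb{C}[\mathbf{x},\mathbf{y},\boldsymbol\eta,\boldsymbol\zeta]$ is the polynomial superalgebra generated by even (commuting) variables $x_i^l$ ($1\le i\le m$), $y_r^l$ ($1\le r\le p$) and odd (anticommuting) variables $\eta_j^l$ ($1\le j\le n$), $\zeta_s^l$ ($1\le s\le q$), $1\le l\le d$. The action $\Phi$ of $gl_d\times gl_{m+p|n+q}$ is (products are compositions of operators; sums over $l=1,\dots,d$ unless indicated; $i,i'\le m$, $j,j'\le n$, $r,r'\le p$, $s,s'\le q$) $$\Phi(e_{ab})=\sum_{k=1}^m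 x_k^a\tfrac{\partial}{\partial x_k^b}+\sum_{k=1}^n\eta_k^a\tfrac{\partial}{\partial\eta_k^b}-\sum_{k=1}^p y_k^b\tfrac{\partial}{\partial y_k^a}-\sum_{k=1}^q\zeta_k^b\tfrac{\partial}{\partial\zeta_k^a},\quad 1\le a,b\le d,$$ $$\Phi(E^r_{r'})=-\sum_l\tfrac{\partial}{\partial y_r^l}y_{r'}^l,\quad \Phi(E^{p+s}_{p+s'})=\sum_l\tfrac{\partial}{\partial\zeta_s^l}\zeta_{s'}^l,\quad \Phi(E^{p+s}_r)=-\sum_l\tfrac{\partial}{\partial\zeta_s^l}y_r^l,\quad \Phi(E^r_{p+s})=\sum_l\tfrac{\partial}{\partial y_r^l}\zeta_s^l,$$ $$\Phi(E^{p+q+i}_{p+q+i'})=\sum_l x_i^l\tfrac{\partial}{\partial x_{i'}^l},\quad \Phi(E^{m+p+q+j}_{m+p+q+j'})=\sum_l\eta_j^l\tfrac{\partial}{\partial\eta_{j'}^l},$$ $$\Phi(E^{p+q+i}_{m+p+q+j})=\sum_l x_i^l\tfrac{\partial}{\partial\eta_j^l},\quad \Phi(E^{m+p+q+j}_{p+q+i})=\sum_l\eta_j^l\tfrac{\partial}{\partial x_i^l},$$ $$\Phi(E^r_{p+q+i})=\sum_l\tfrac{\partial}{\partial y_r^l}\tfrac{\partial}{\partial x_i^l},\quad \Phi(E^r_{m+p+q+j})=\sum_l\tfrac{\partial}{\partial y_r^l}\tfrac{\partial}{\partial\eta_j^l},\quad \Phi(E^{p+s}_{p+q+i})=\sum_l\tfrac{\partial}{\partial\zeta_s^l}\tfrac{\partial}{\partial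 x_i^l},\quad \Phi(E^{p+s}_{m+p+q+j})=\sum_l\tfrac{\partial}{\partial\zeta_s^l}\tfrac{\partial}{\partial\eta_j^l},$$ $$\Phi(E^{p+q+i}_r)=-\sum_l x_i^ly_r^l,\quad \Phi(E^{p+q+i}_{p+s})=\sum_l x_i^l\zeta_s^l,\quad \Phi(E^{m+p+q+j}_r)=-\sum_l\eta_j^ly_r^l,\quad \Phi(E^{m+p+q+j}_{p+s})=\sum_l\eta_j^l\zeta_s^l.$$ *)

(* Defs.v *)
From mathcomp Require Import all_boot all_order all_algebra.
From mathcomp Require Import complex reals.
From mathcomp Require Import mpoly.

Set Implicit Arguments.
Unset Strict Implicit.
Unset Printing Implicit Defensive.

Import GRing.Theory.
Local Open Scope ring_scope.

(* The polynomial superalgebra over K with even generators indexed by I and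
   odd generators indexed by J.  The finite type J is ordered by enum_rank; for
   S = {j_1 < ... < j_k}, the polynomial f S is the coefficient in f of the odd
   monomial xi_{j_1} ... xi_{j_k}.  All even and odd generators are part of a
   single superalgebra, so that any two odd generators anticommute. *)
Notation superpoly K I J := {ffun {set J} -> {mpoly K[#|{: I}|]}}.

Section SuperPolynomials.

Variables (K : comNzRingType) (I J : finType).
Implicit Type f : superpoly K I J.

Definition mul_even (i : I) f : superpoly K I J :=
  [ffun S : {set J} => 'X_(enum_rank i) * f S].

Definition der_even (i : I) f : superpoly K I J :=
  [ffun S : {set J} => mderiv (enum_rank i) (f S)].

(* The sign produced by moving xi_j to its place in the odd monomial of S. *)
Definition odd_sign (j : J) (S : {set J}) : K :=
  (-1) ^+ #|[set k in S | (enum_rank k < enum_rank j)%N]|.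

(* Left multiplication by xi_j. *)
Definition mul_odd (j : J) f : superpoly K I J :=
  [ffun S : {set J} => if j \in S then odd_sign j S *: f (S :\ j) else 0].

(* The left derivative: xi_j xi_{j_1} ... xi_{j_k} is sent to
   xi_{j_1} ... xi_{j_k} if j is not one of the j_a, and monomials without xi_j
   are sent to 0. *)
Definition der_odd (j : J) f : superpoly K I J :=
  [ffun S : {set J} => if j \notin S then odd_sign j S *: f (j |: S) else 0].

End SuperPolynomials.

Section Modules.

Variables (K : pzRingType) (V : lmodType K) (L : Type) (rho : L -> V -> V).
Implicit Types U W : V -> Prop.

Record is_submodule W : Prop := IsSubmodule {
  submodule0 : W 0;
  submoduleD : forall u v, W u -> W v -> W (u + v);
  submoduleZ : forall c v, W v -> W (c *: v);
  submodule_act : forall g v, W v -> W (rho g v) }.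

Definition irreducible_submodule W : Prop :=
  [/\ is_submodule W,
      exists2 v, W v & v <> 0 &
      forall U, is_submodule U -> (forall v, U v -> W v) ->
        (forall v, U v -> v = 0) \/ (forall v, W v -> U v)].

Definition generated_by W (v : V) : Prop :=
  [/\ is_submodule W, W v &
      forall U, is_submodule U -> U v -> forall w, W w -> U w].

End Modules.

Section Action.

Variables (R : realType) (d m n p q : nat).

Local Notation C := R[i].

Local Notation evar := (('I_m + 'I_p) * 'I_d)%type.
Local Notation ovar := (('I_n + 'I_q) * 'I_d)%type.
Local Notation V := (superpoly C evar ovar).

Local Notation x i l := (mul_even (inl i, l)).
Local Notation y r l := (mul_even (inr r, l)).
Local Notation eta j l := (mul_odd (inl j, l)).
Local Notation zeta s l := (mul_odd (inr s, l)).
Local Notation dx i l := (der_even (inl i, l)).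
Local Notation dy r l := (der_even (inr r, l)).
Local Notation deta j l := (der_odd (inl j, l)).
Local Notation dzeta s l := (der_odd (inr s, l)).

Definition Phi_e (a b : 'I_d) (f : V) : V :=
    \sum_(k < m) x k a (dx k b f)
  + \sum_(k < n) eta k a (deta k b f)
  - \sum_(k < p) y k b (dy k a f)
  - \sum_(k < q) zeta k b (dzeta k a f).

(* The basis v_A of the natural module, in increasing order of A: p even
   vectors (for y), q odd ones (for zeta), m even ones (for x) and n odd ones
   (for eta). *)
Variant basis_index : Type :=
  | Iy of 'I_p | Izeta of 'I_q | Ix of 'I_m | Ieta of 'I_n.

Definition basis_block (A : 'I_(p + q + m + n)) : basis_index :=
  match split A with
  | inr j => Ieta j
  | inl A1 => match split A1 with
    | inr i => Ix i
    | inl A2 => match split A2 with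
      | inl r => Iy r
      | inr s => Izeta s
      end
    end
  end.

(* Phi_E A B is the action of the elementary matrix with row index A and
   column index B. *)
Definition Phi_E (A B : 'I_(p + q + m + n)) (f : V) : V :=
  match basis_block A, basis_block B with
  | Iy r,    Iy r'    => - \sum_(l < d) dy r l (y r' l f)
  | Izeta s, Izeta s' => \sum_(l < d) dzeta s l (zeta s' l f)
  | Izeta s, Iy r     => - \sum_(l < d) dzeta s l (y r l f)
  | Iy r,    Izeta s  => \sum_(l < d) dy r l (zeta s l f)
  | Ix i,    Ix i'    => \sum_(l < d) x i l (dx i' l f)
  | Ieta j,  Ieta j'  => \sum_(l < d) eta j l (deta j' l f)
  | Ix i,    Ieta j   => \sum_(l < d) x i l (deta j l f)
  | Ieta j,  Ix i     => \sum_(l < d) eta j l (dx i l f)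
  | Iy r,    Ix i     => \sum_(l < d) dy r l (dx i l f)
  | Iy r,    Ieta j   => \sum_(l < d) dy r l (deta j l f)
  | Izeta s, Ix i     => \sum_(l < d) dzeta s l (dx i l f)
  | Izeta s, Ieta j   => \sum_(l < d) dzeta s l (deta j l f)
  | Ix i,    Iy r     => - \sum_(l < d) x i l (y r l f)
  | Ix i,    Izeta s  => \sum_(l < d) x i l (zeta s l f)
  | Ieta j,  Iy r     => - \sum_(l < d) eta j l (y r l f)
  | Ieta j,  Izeta s  => \sum_(l < d) eta j l (zeta s l f)
  end.

(* Submodules for Phi are not required to be Z/2-graded because they always
   are: the operators Phi_E A A are diagonal on monomials and their eigenvalues
   determine the number of odd variables, so a stable subspace contains the even
   and odd components of its elements.  Graded and ungraded irreducibility
   therefore coincide. *)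
Definition Phi (gX : 'M[C]_d * 'M[C]_(p + q + m + n)) (f : V) : V :=
    \sum_(a < d) \sum_(b < d) gX.1 a b *: Phi_e a b f
  + \sum_A \sum_B gX.2 A B *: Phi_E A B f.

(* The Borel subalgebra consists of the pairs of upper triangular matrices
   (is_trig_mx means lower triangular).  Through the diagonal entries, it acts
   on a highest weight vector by the weight (lam, mu); in particular, strictly
   upper triangular matrices act by 0. *)
Definition in_borel (gX : 'M[C]_d * 'M[C]_(p + q + m + n)) : bool :=
  is_trig_mx gX.1^T && is_trig_mx gX.2^T.

Definition highest_weight_vector (v : V) : Prop :=
  v <> 0 /\
  exists (lam : 'I_d -> C) (mu : 'I_(p + q + m + n) -> C),
    forall gX, in_borel gX ->
      Phi gX v = (\sum_a gX.1 a a * lam a + \sum_A gX.2 A A * mu A) *: v.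

Definition highest_weight_type (W : V -> Prop) : Prop :=
  exists2 v, highest_weight_vector v & generated_by Phi W v.

End Action.

(* Main.v *)
Require Import Defs.
From mathcomp Require Import all_boot all_order all_algebra.
From mathcomp Require Import complex reals boolp.
From mathcomp Require Import mpoly.
From mathcomp Require Import zify.

(** Give every variable a positive integer weight, increasing along the order
    in which its row and column indices occur in the two Borel subalgebras for
    x and eta, and decreasing for y and zeta.  Every strictly upper triangular
    elementary matrix then acts by strictly lowering the height (total weight)
    of monomials, and the diagonal ones are diagonal in the monomial basis.
    A nonzero vector of W whose maximal height is as small as possible is
    therefore killed by the strictly upper triangular part.  Among these, one
    with the fewest monomials is a weight vector: otherwise H v - c v, with c
    the eigenvalue of H on some monomial of v, would be a shorter nonzero vector
    of W.  By irreducibility it generates W. *)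

Set Implicit Arguments.
Unset Strict Implicit.
Unset Printing Implicit Defensive.

Import Order.TTheory GRing.Theory Num.Theory.
Local Open Scope ring_scope.

(** * Coefficients of superpolynomials and operators diagonal in the monomial basis *)

Section Monomials.

Variables (K : comNzRingType) (I J : finType).
Local Notation V := (superpoly K I J).
Local Notation monomial := ({set J} * 'X_{1..#|{: I}|})%type.
Implicit Types (f g : V) (u v : monomial).

Definition coef f u : K := (f u.1)@_u.2.

Lemma coefP f g : (forall u, coef f u = coef g u) -> f = g.
Proof.
by move=> e; apply/ffunP => S; apply/mpolyP => k; exact: (e (S, k)).
Qed.

Lemma coef0 u : coef 0 u = 0.
Proof. by rewrite /coef ffunE mcoeff0. Qed.

Lemma coefD f g u : coef (f + g) u = coef f u + coef g u.
Proof. by rewrite /coef ffunE mcoeffD. Qed.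

Lemma coefN f u : coef (- f) u = - coef f u.
Proof. by rewrite /coef ffunE mcoeffN. Qed.

Lemma coefZ c f u : coef (c *: f) u = c * coef f u.
Proof. by rewrite /coef ffunE mcoeffZ. Qed.

Lemma coef_sum T (r : seq T) (F : T -> V) u :
  coef (\sum_(i <- r) F i) u = \sum_(i <- r) coef (F i) u.
Proof.
by apply: (big_morph (coef^~ u)) => [f g|]; rewrite ?coefD ?coef0.
Qed.

(** Subtraction of exponents is truncated, so a monomial without the variable has to be treated as a
    separate case. *)
Lemma coef_mul_even i f S k :
  coef (mul_even i f) (S, k)
  = if k (enum_rank i) == 0%N then 0 else coef f (S, (k - U_(enum_rank i))%MM).
Proof.
rewrite /coef ffunE /= mulrC; case: eqP => [k0|/eqP k1].
  apply/eqP; rewrite mcoeff_eq0 (perm_mem (msuppMX _ _)).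
  by apply/mapP => -[k' _ kE]; move: k0; rewrite kE mnmDE mnm1E eqxx.
by rewrite -{1}(@submK _ U_(enum_rank i)%MM k) ?lep1mP // addmC mcoeffMX.
Qed.

Lemma coef_der_even i f S k :
  coef (der_even i f) (S, k)
  = coef f (S, (k + U_(enum_rank i))%MM) *+ (k (enum_rank i)).+1.
Proof. by rewrite /coef ffunE mcoeff_deriv. Qed.

Lemma coef_mul_odd j f S k :
  coef (mul_odd j f) (S, k)
  = if j \in S then odd_sign K j S * coef f (S :\ j, k) else 0.
Proof. by rewrite /coef ffunE /=; case: ifP; rewrite ?mcoeffZ ?mcoeff0. Qed.

Lemma coef_der_odd j f S k :
  coef (der_odd j f) (S, k)
  = if j \in S then 0 else odd_sign K j S * coef f (j |: S, k).
Proof.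
by rewrite /coef ffunE /=; case: (j \in S); rewrite ?mcoeffZ ?mcoeff0.
Qed.

Definition diagonal (T : V -> V) : Prop :=
  exists c : monomial -> K, forall f u, coef (T f) u = c u * coef f u.

Lemma diagonalD T1 T2 :
  diagonal T1 -> diagonal T2 -> diagonal (fun f => T1 f + T2 f).
Proof.
move=> [c1 E1] [c2 E2]; exists (fun u => c1 u + c2 u) => f u.
by rewrite coefD E1 E2 mulrDl.
Qed.

Lemma diagonalN T : diagonal T -> diagonal (fun f => - T f).
Proof.
by move=> [c E]; exists (fun u => - c u) => f u; rewrite coefN E mulNr.
Qed.

Lemma diagonal_sum n (T : 'I_n -> V -> V) :
  (forall i, diagonal (T i)) -> diagonal (fun f => \sum_(i < n) T i f).
Proof.
move=> /fin_all_exists[c E]; exists (fun u => \sum_i c i u) => f u.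
by rewrite coef_sum mulr_suml; apply: eq_bigr => i _; exact: E.
Qed.

Lemma diagonal_mul_der_even i : diagonal (fun f => mul_even i (der_even i f)).
Proof.
exists (fun u => (u.2 (enum_rank i))%:R) => f [S k] /=.
rewrite coef_mul_even coef_der_even; case: eqP => [->|/eqP k1].
  by rewrite mul0r.
rewrite submK ?lep1mP // mnmBE mnm1E eqxx.
by rewrite subn1 prednK ?lt0n // mulr_natl.
Qed.

Lemma diagonal_der_mul_even i : diagonal (fun f => der_even i (mul_even i f)).
Proof.
exists (fun u => (u.2 (enum_rank i)).+1%:R) => f [S k] /=.
by rewrite coef_der_even coef_mul_even mnmDE mnm1E eqxx addn1 addmK mulr_natl.
Qed.

(** Both signs count the same elements preceding [j], so the eigenvalue is 1 when [j] occurs; for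
    diagonality it suffices that it does not depend on [f]. *)
Lemma diagonal_mul_der_odd j : diagonal (fun f => mul_odd j (der_odd j f)).
Proof.
exists (fun u => if j \in u.1 then odd_sign K j u.1 * odd_sign K j (u.1 :\ j)
                 else 0) => f [S k] /=.
rewrite coef_mul_odd coef_der_odd; case: ifP => jS; last by rewrite mul0r.
by rewrite setD11 setD1K // mulrA.
Qed.

Lemma diagonal_der_mul_odd j : diagonal (fun f => der_odd j (mul_odd j f)).
Proof.
exists (fun u => if j \in u.1 then 0
                 else odd_sign K j u.1 * odd_sign K j (j |: u.1)) => f [S k] /=.
rewrite coef_der_odd coef_mul_odd; case: ifPn => jS; first by rewrite mul0r.
by rewrite setU11 setU1K // mulrA.
Qed.

(** * Weighted degree and its change under multiplications and derivatives *)

Section Height.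

Variables (wI : I -> nat) (wJ : J -> nat).

Definition height u : nat :=
  (\sum_i u.2 (enum_rank i) * wI i + \sum_(j in u.1) wJ j)%N.

Lemma heightU1 S k i :
  height (S, (k + U_(enum_rank i))%MM) = (height (S, k) + wI i)%N.
Proof.
rewrite /height /= addnAC; congr (_ + _)%N.
under eq_bigr do rewrite mnmDE mnm1E mulnDl.
rewrite big_split /= (bigD1 i) //= [X in (_ + X)%N](bigD1 i) //= eqxx mul1n.
rewrite [in X in (_ + (_ + X))%N]big1 ?addn0 // => i' i'i.
by rewrite (inj_eq enum_rank_inj) eq_sym (negbTE i'i).
Qed.

Lemma height_setU1 (S : {set J}) k j :
  j \notin S -> height (j |: S, k) = (height (S, k) + wJ j)%N.
Proof. by move=> jS; rewrite /height /= big_setU1 //= addnCA addnC. Qed.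

(** Formulated through supports of arbitrary [f], so that composition needs no linearity. The shift
    is an integer because derivatives decrease the height. *)
Definition shifts (T : V -> V) (s : int) : Prop :=
  forall f u, coef (T f) u != 0 ->
    exists2 v, coef f v != 0 & (height u)%:Z = (height v)%:Z + s.

Definition lowering (T : V -> V) : Prop :=
  forall f u, coef (T f) u != 0 ->
    exists2 v, coef f v != 0 & (height u < height v)%N.

(** Only the total shift matters: one of the two factors may raise the height. *)
Lemma lowering_comp T1 T2 s1 s2 : shifts T1 s1 -> shifts T2 s2 ->
  s1 + s2 < 0 -> lowering (fun f => T1 (T2 f)).
Proof.
move=> sT1 sT2 s0 f u /sT1[v /sT2[w fw hv] hu]; exists w => //; lia.
Qed.

Lemma loweringD T1 T2 :
  lowering T1 -> lowering T2 -> lowering (fun f => T1 f + T2 f).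
Proof.
move=> l1 l2 f u; rewrite coefD; have [->|/l1//] := eqVneq (coef (T1 f) u) 0.
by rewrite add0r => /l2.
Qed.

Lemma loweringN T : lowering T -> lowering (fun f => - T f).
Proof. by move=> l f u; rewrite coefN oppr_eq0 => /l. Qed.

Lemma lowering_sum n (T : 'I_n -> V -> V) :
  (forall i, lowering (T i)) -> lowering (fun f => \sum_(i < n) T i f).
Proof.
move=> l f u; rewrite coef_sum => Tu.
have [i Tiu] : exists i, coef (T i f) u != 0.
  apply/existsP; apply: contraNT Tu; rewrite negb_exists => /forallP T0.
  by rewrite big1 // => i _; apply/eqP; rewrite -[_ == _]negbK T0.
exact: l Tiu.
Qed.

Lemma shifts_mul_even i : shifts (mul_even i) (wI i).
Proof.
move=> f [S k]; rewrite coef_mul_even.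
have [_|k1 fv] := eqVneq (k (enum_rank i)) 0%N.
  by rewrite eqxx.
exists (S, (k - U_(enum_rank i))%MM) => //.
by rewrite -PoszD -heightU1 submK ?lep1mP.
Qed.

Lemma shifts_der_even i : shifts (der_even i) (- (wI i)%:Z).
Proof.
move=> f [S k]; rewrite coef_der_even => fv.
exists (S, (k + U_(enum_rank i))%MM).
  by apply: contraNneq fv => ->; rewrite mul0rn.
by rewrite heightU1 PoszD addrK.
Qed.

Lemma shifts_mul_odd j : shifts (mul_odd j) (wJ j).
Proof.
move=> f [S k]; rewrite coef_mul_odd; case: ifP => [jS fv|_]; last first.
  by rewrite eqxx.
exists (S :\ j, k); first by apply: contraNneq fv => ->; rewrite mulr0.
by rewrite -PoszD -height_setU1 ?setD1K ?setD11.
Qed.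

Lemma shifts_der_odd j : shifts (der_odd j) (- (wJ j)%:Z).
Proof.
move=> f [S k]; rewrite coef_der_odd; case: ifPn => [_|jS fv].
  by rewrite eqxx.
exists (j |: S, k); first by apply: contraNneq fv => ->; rewrite mulr0.
by rewrite height_setU1 // PoszD addrK.
Qed.

End Height.

Definition support f : seq monomial :=
  flatten [seq [seq (A, k) | k <- msupp (f A)] | A <- enum {: {set J}}].

Lemma mem_support f u : coef f u != 0 -> u \in support f.
Proof.
case: u => S k fu; apply/flatten_mapP; exists S; first by rewrite mem_enum.
by apply/map_f; rewrite mcoeff_msupp.
Qed.

Lemma coef_neq0 f : f <> 0 -> exists u, coef f u != 0.
Proof.
move=> f0; apply: contrapT => nf; apply: f0; apply: coefP => u.
by rewrite coef0; apply/eqP/negPn/negP => fu; apply: nf; exists u.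
Qed.

End Monomials.

(** * Extremal vectors in a stable subspace *)

Lemma exists_minimal (P : nat -> Prop) :
  (exists k, P k) -> exists2 k, P k & forall l, P l -> (k <= l)%N.
Proof.
move=> exP; have exPb : exists k, `[< P k >].
  by case: exP => k Pk; exists k; apply/asboolP.
by case: (ex_minnP exPb) => k /asboolP Pk mk; exists k => // l /asboolP /mk.
Qed.

(** The operators are quantified after [f]: one vector serves all of them at once, which yields a
    common eigenvector. *)
Lemma exists_extremal_vector (K : comNzRingType) (I J : finType)
    (wI : I -> nat) (wJ : J -> nat) (W : superpoly K I J -> Prop) :
  (forall f g, W f -> W g -> W (f + g)) ->
  (forall c f, W f -> W (c *: f)) ->
  (exists2 f, W f & f <> 0) ->
  exists f, [/\ W f, f <> 0,
    forall T, (forall g, W g -> W (T g)) -> lowering wI wJ T -> T f = 0 &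
    forall T, (forall g, W g -> W (T g)) -> diagonal T ->
      exists c, T f = c *: f].
Proof.
move=> WD WZ [f0 Wf0 f0_neq0].
pose bounded N (f : superpoly K I J) := forall u, coef f u != 0 -> (height wI wJ u < N)%N.
have exN : exists N f, [/\ W f, f <> 0 & bounded N f].
  exists (\max_(u <- support f0) height wI wJ u).+1, f0; split=> // u fu.
  by rewrite ltnS leq_bigmax_seq ?mem_support.
have {exN}[N [f1 f1P] minN] := exists_minimal exN.
(* A list merely containing the support, possibly with repetitions, stands in for the number of
   monomials. Its length is minimised among vectors already bounded by the minimal [N]. *)
pose covered (s : seq ({set J} * 'X_{1..#|{: I}|})) (f : superpoly K I J) := forall u, coef f u != 0 -> u \in s.
have exs : exists k s f, [/\ size s = k, W f, f <> 0, bounded N f & covered s f].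
  case: f1P => Wf1 f1_neq0 bf1.
  by exists (size (support f1)), (support f1), f1; split=> // u /mem_support.
have {exs}[k [s [f [sk Wf f_neq0 bf sf]]] mink] := exists_minimal exs.
exists f; split=> // T WT.
  move=> lT; apply: contrapT => Tf_neq0.
  have [u fu] := coef_neq0 f_neq0.
  (* All monomials of [T f] have height below [N.-1]. Since [f] has a monomial of height below [N],
     [N] is positive, and this contradicts minimality. *)
  have : (N <= N.-1)%N.
    apply: minN; exists (T f); split=> // [|v /lT[w /bf]]; first exact: WT.
    lia.
  have := bf u fu; lia.
move=> [c cT]; have [u fu] := coef_neq0 f_neq0.
exists (c u); apply: contrapT => /eqP; rewrite -subr_eq0 => /eqP g_neq0.
pose g := T f - c u *: f.
have coefg v : coef g v = (c v - c u) * coef f v.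
  by rewrite coefD coefN coefZ cT mulrBl.
have gf v : coef g v != 0 -> coef f v != 0.
  by rewrite coefg; apply: contraNneq => ->; rewrite mulr0.
have : (k <= size (filter (predC1 u) s))%N.
  apply: mink; exists (filter (predC1 u) s), g; split=> // [||v gv].
  - by rewrite /g -scaleNr; apply: WD; [exact: WT | exact: WZ].
  - by move=> v /gf /bf.
  rewrite mem_filter sf ?gf // andbT /=.
  by apply: contraNneq gv => ->; rewrite coefg subrr mul0r.
(* Every copy of [u] has been deleted and [u] does occur in [s], so the new list is strictly
   shorter. *)
rewrite size_filter leqNgt -sk -(count_predC (pred1 u) s).
by rewrite -[X in (X < _)%N]add0n ltn_add2r -has_count has_pred1 sf.
Qed.

(** * Sums over matrix entries, and cyclicity of irreducible submodules *)

Section TriangularSums.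

Variables (K : nzRingType) (V : lmodType K) (n : nat) (F : 'I_n -> 'I_n -> V).

Lemma sum_delta_mx_scale a b :
  \sum_i \sum_j (delta_mx a b : 'M[K]_n) i j *: F i j = F a b.
Proof.
rewrite (bigD1 a) //= [X in _ + X]big1 => [|i ia]; last first.
  by apply: big1 => j _; rewrite mxE (negbTE ia) scale0r.
rewrite addr0 (bigD1 b) //= big1 => [|j jb]; last first.
  by rewrite mxE (negbTE jb) andbF scale0r.
by rewrite addr0 mxE !eqxx scale1r.
Qed.

(** Below the diagonal the entries of [X] vanish, above it the vectors [F i j] do. *)
Lemma sum_upper_triangular (X : 'M[K]_n) (c : 'I_n -> K) (v : V) :
  is_trig_mx X^T ->
  (forall i j : 'I_n, (i < j)%N -> F i j = 0) -> (forall i, F i i = c i *: v) ->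
  \sum_i \sum_j X i j *: F i j = (\sum_i X i i * c i) *: v.
Proof.
move=> /is_trig_mxP trX F0 Fd; rewrite scaler_suml; apply: eq_bigr => i _.
rewrite (bigD1 i) //= big1 => [|j ji]; first by rewrite addr0 Fd scalerA.
case: (ltngtP i j) => [/F0 ->|/trX|/val_inj eij]; first by rewrite scaler0.
  by rewrite mxE => ->; rewrite scale0r.
by rewrite eij eqxx in ji.
Qed.

End TriangularSums.

(** The competing submodule [U] need not lie in [W], so irreducibility is applied to the
    intersection of [U] and [W]. *)
Lemma irreducible_generated (K : pzRingType) (V : lmodType K) (L : Type)
    (rho : L -> V -> V) (W : V -> Prop) (v : V) :
  irreducible_submodule rho W -> W v -> v <> 0 -> generated_by rho W v.
Proof.
move=> [subW _ irrW] Wv v0; split=> // U subU Uv w Ww.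
have [||UW0|WU] := irrW (fun x => U x /\ W x).
- case: subU subW => [U0 UD UZ Ua] [W0 WD WZ Wa].
  by split=> [|x y [? ?] [? ?]|c x [? ?]|g x [? ?]]; split; auto.
- by move=> x [].
- by case: v0; apply: UW0.
- by case: (WU w Ww).
Qed.

(** * Weights of the variables and the elementary operators of the action *)

Section Oscillator.

Variables (R : realType) (d m n p q : nat).
Local Notation evar := (('I_m + 'I_p) * 'I_d)%type.
Local Notation ovar := (('I_n + 'I_q) * 'I_d)%type.
Local Notation V := (superpoly R[i] evar ovar).

(** For x the weight is the position in the ordered basis plus the column index, plus one; for y
    both are subtracted from a constant large enough that truncation never occurs. Positive weights
    make products of two derivatives lowering. *)
Definition weight_even (v : evar) : nat :=
  match v.1 with
  | inl i => (p + q + i + v.2).+1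
  | inr r => p + q + m + n + d - r - v.2
  end%N.

Definition weight_odd (v : ovar) : nat :=
  match v.1 with
  | inl j => (p + q + m + j + v.2).+1
  | inr s => p + q + m + n + d - (p + s) - v.2
  end%N.

Lemma val_basis_block (A : 'I_(p + q + m + n)) :
  A = match basis_block A with
      | Iy r => r
      | Izeta s => p + s
      | Ix i => p + q + i
      | Ieta j => p + q + m + j
      end%N :> nat.
Proof.
rewrite /basis_block; case: (splitP A) => [A1 ->|j -> //].
case: (splitP A1) => [A2 ->|i -> //].
by case: (splitP A2) => [r ->|s -> //].
Qed.

Local Notation lower := (lowering weight_even weight_odd).

Ltac shifts_tac :=
  first [ exact: shifts_mul_even | exact: shifts_der_even
        | exact: shifts_mul_odd | exact: shifts_der_odd ].

Ltac lower_tac :=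
  apply: lowering_comp;
  [ shifts_tac | shifts_tac | rewrite /weight_even /weight_odd /=; lia ].

Lemma lowering_Phi_e (a b : 'I_d) :
  (a < b)%N -> lower (@Phi_e R d m n p q a b).
Proof.
move=> ab; have bd := ltn_ord b.
rewrite /Phi_e; apply: loweringD; first apply: loweringD.
- apply: loweringD; apply: lowering_sum => k; lower_tac.
- apply: loweringN; apply: lowering_sum => k; have ? := ltn_ord k; lower_tac.
- apply: loweringN; apply: lowering_sum => k; have ? := ltn_ord k; lower_tac.
Qed.

Lemma lowering_Phi_E (A B : 'I_(p + q + m + n)) :
  (A < B)%N -> lower (@Phi_E R d m n p q A B).
Proof.
have := val_basis_block A; have := val_basis_block B; rewrite /Phi_E /=.
(* Of the sixteen pairs of blocks, the six with the row block after the column block contradict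
   [A < B]. *)
case: (basis_block A) => a; case: (basis_block B) => b -> -> ab;
  have := ltn_ord a; have := ltn_ord b => ? ?; try (exfalso; lia);
  try apply: loweringN; apply: lowering_sum => l; have ? := ltn_ord l;
  lower_tac.
Qed.

Lemma diagonal_Phi_e (a : 'I_d) : diagonal (@Phi_e R d m n p q a a).
Proof.
rewrite /Phi_e; apply: diagonalD; first apply: diagonalD;
  first apply: diagonalD; try apply: diagonalN; apply: diagonal_sum => k;
  first [exact: diagonal_mul_der_even | exact: diagonal_mul_der_odd].
Qed.

Lemma diagonal_Phi_E (A : 'I_(p + q + m + n)) :
  diagonal (@Phi_E R d m n p q A A).
Proof.
rewrite /Phi_E; case: (basis_block A) => a; try apply: diagonalN;
  apply: diagonal_sum => l;
  first [exact: diagonal_mul_der_even | exact: diagonal_mul_der_odd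
        | exact: diagonal_der_mul_even | exact: diagonal_der_mul_odd].
Qed.

(** Stability of a submodule is assumed for [Phi]; elementary matrices transfer it to the individual
    operators. *)
Lemma Phi_delta_e a b (f : V) : Phi (delta_mx a b, 0) f = Phi_e a b f.
Proof.
rewrite /Phi /= (sum_delta_mx_scale (fun a b => Phi_e a b f)).
by rewrite big1 ?addr0 // => A _; rewrite big1 // => B _; rewrite mxE scale0r.
Qed.

Lemma Phi_delta_E A B (f : V) : Phi (0, delta_mx A B) f = Phi_E A B f.
Proof.
rewrite /Phi /= (sum_delta_mx_scale (fun A B => Phi_E A B f)).
by rewrite big1 ?add0r // => a _; rewrite big1 // => b _; rewrite mxE scale0r.
Qed.

End Oscillator.

Theorem lemma3p1 (R : realType) (d m n p q : nat) (hd : (1 <= d)%N)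
    (W : superpoly R[i] (('I_m + 'I_p) * 'I_d) (('I_n + 'I_q) * 'I_d) -> Prop) :
  irreducible_submodule (@Phi R d m n p q) W ->
  @highest_weight_type R d m n p q W.
Proof.
move=> irrW; have [subW exW _] := irrW.
have [v [Wv v0 lowv diagv]] := exists_extremal_vector (@weight_even d m n p q)
  (@weight_odd d m n p q) (submoduleD subW) (submoduleZ subW) exW.
exists v; last exact: irreducible_generated.
have We a b f : W f -> W (Phi_e a b f).
  by rewrite -Phi_delta_e; exact: submodule_act.
have WE A B f : W f -> W (Phi_E A B f).
  by rewrite -Phi_delta_E; exact: submodule_act.
(* The eigenvalues on the diagonal elementary matrices, collected into functions, form the highest
   weight. *)
have /fin_all_exists[lam lamP] a : exists c, Phi_e a a v = c *: v.
  by apply: diagv (We a a) _; exact: diagonal_Phi_e.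
have /fin_all_exists[mu muP] A : exists c, Phi_E A A v = c *: v.
  by apply: diagv (WE A A) _; exact: diagonal_Phi_E.
split=> //; exists lam, mu => gX /andP[trg trX]; rewrite scalerDl /Phi.
congr (_ + _); apply: sum_upper_triangular => // i j ij.
  exact: lowv (We i j) (lowering_Phi_e ij).
exact: lowv (WE i j) (lowering_Phi_E ij).
Qed.
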